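(* Fix an integer $n\ge 2$ and real parameters $\beta>R>0$ and $c>0$. Let $\mathbf{E}=\mathbf{e}\mathbf{e}^\top$ be the $n\times n$ all-ones matrix, $\mathbf{I}$ the identity, set $\rho:=R/(n-1)$, and define $$\mathbf{B}:=\beta\mathbf{I}+\rho(\mathbf{E}-\mathbf{I}),\quad \mathbf{A}:=c\,\mathbf{B}.$$ Then $\mathbf{B}$ is strictly diagonally dominant and positive definite, and $\mathbf{A}$ is copositive. Moreover, $$\operatorname{conv}(K_1)=\operatorname{conv}(K_2)=\left[\frac{c\beta}{\beta+R},\ \frac{c(\beta+R)}{\beta}\right],\quad [\mu_{\min}(\mathbf{A},\mathbf{B}),\mu_{\max}(\mathbf{A},\mathbf{B})]=\{c\}.$$ Hence $[\mu_{\min}(\mathbf{A},\mathbf{B}),\mu_{\max}(\mathbf{A},\mathbf{B})]\subsetneq K_1=K_2$.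
   Context: $[n]=\{1,\dots,n\}$; $\mathbf{e}\in\mathbb{R}^n$ is the all-ones vector; $\operatorname{conv}$ is the convex hull. A matrix $\mathbf{M}=(m_{ij})$ is strictly diagonally dominant if $|m_{ii}|>\sum_{j\ne i}|m_{ij}|$ for every $i\in[n]$. A symmetric matrix $\mathbf{A}$ is copositive if $\mathbf{x}^\top\mathbf{A}\mathbf{x}\ge 0$ for all componentwise nonnegative $\mathbf{x}$. For $\mathbf{B}$ positive definite, $$\mu_{\min}(\mathbf{A},\mathbf{B}):=\min_{\mathbf{x}\ne\mathbf{0}}\frac{\mathbf{x}^\top\mathbf{A}\mathbf{x}}{\mathbf{x}^\top\mathbf{B}\mathbf{x}},\quad \mu_{\max}(\mathbf{A},\mathbf{B}):=\max_{\mathbf{x}\ne\mathbf{0}}\frac{\mathbf{x}^\top\mathbf{A}\mathbf{x}}{\mathbf{x}^\top\mathbf{B}\mathbf{x}}$$ are the smallest and largest generalized eigenvalues of $(\mathbf{A},\mathbf{B})$. For $\mathbf{M}\in\mathbb{R}^{n\times n}$ set $$r_i^+(\mathbf{M}):=\sum_{j\ne i}\max\{m_{ij},0\},\quad r_i^-(\mathbf{M}):=-\sum_{j\ne i}\min\{m_{ij},0\},$$ $$m_i^+:=m_{ii}+r_i^+(\mathbf{M}),\quad m_i^-:=m_{ii}-r_i^-(\mathbf{M}),$$ $$m_{ij}^+:=m_{ii}m_{jj}-r_i^+(\mathbf{M})r_j^+(\mathbf{M}),\quad m_{ij}^-:=m_{ii}m_{jj}-r_i^-(\mathbf{M})r_j^-(\mathbf{M}).$$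 Thus $a_i^\pm,a_{ij}^\pm$ and $b_i^\pm,b_{ij}^\pm$ denote these quantities for $\mathbf{A}=(a_{ij})$ and $\mathbf{B}=(b_{ij})$. Further, $$s_{ij}^+(\mathbf{A},\mathbf{B}):=a_{ii}b_{jj}+a_{jj}b_{ii}+r_i^+(\mathbf{A})r_j^-(\mathbf{B})+r_j^+(\mathbf{A})r_i^-(\mathbf{B}),$$ $$s_{ij}^-(\mathbf{A},\mathbf{B}):=a_{ii}b_{jj}+a_{jj}b_{ii}+r_i^-(\mathbf{A})r_j^+(\mathbf{B})+r_j^-(\mathbf{A})r_i^+(\mathbf{B}),$$ $$P^{\mathrm{up}}_{ij}(y):=b_{ij}^-y^2-s_{ij}^+(\mathbf{A},\mathbf{B})y+a_{ij}^+,\quad P^{\mathrm{low}}_{ij}(y):=b_{ij}^+y^2-s_{ij}^-(\mathbf{A},\mathbf{B})y+a_{ij}^-.$$ The sets are $$K_1:=\bigcup_{i\in[n]}\left[\min\left(\frac{a_i^-}{b_i^-},\frac{a_i^-}{b_i^+}\right),\max\left(\frac{a_i^+}{b_i^-},\frac{a_i^+}{b_i^+}\right)\right],$$ $$K_2:=\bigcup_{\substack{i,j\in[n]\\ i\ne j}}\left[\max\left\{0,\min\{y\in\mathbb{R}\mid P^{\mathrm{low}}_{ij}(y)=0\}\right\},\max\{y\in\mathbb{R}\mid P^{\mathrm{up}}_{ij}(y)=0\}\right].$$ *)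

(* Defs.v *)
From HB Require Import structures.
From mathcomp Require Import all_boot all_order all_algebra.
From mathcomp Require Import boolp classical_sets set_interval reals convex.

Set Implicit Arguments.
Unset Strict Implicit.
Unset Printing Implicit Defensive.

Import Order.TTheory GRing.Theory Num.Theory.

Local Open Scope classical_set_scope.
Local Open Scope ring_scope.

(* Minimum and maximum of a set of reals, required to belong to the set;
   the value 0 is a dummy, returned when there is no such element. *)
Definition set_min (R : realType) (S : set R) : R := xget 0 (S `&` lbound S).
Definition set_max (R : realType) (S : set R) : R := xget 0 (S `&` ubound S).

(* R^o is R seen as a module over itself, as expected by convex_set. *)
Definition conv_hull (R : realType) (S : set R) : set R :=
  smallest (@convex_set R R^o) S.

Definition quad_form (R : realType) (n : nat) (A : 'M[R]_n) (x : 'cV[R]_n) : R :=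
  (x^T *m A *m x) 0 0.

Definition strictly_diag_dominant (R : realType) (n : nat) (M : 'M[R]_n) : Prop :=
  forall i : 'I_n, \sum_(j < n | j != i) `|M i j| < `|M i i|.

Definition positive_definite (R : realType) (n : nat) (A : 'M[R]_n) : Prop :=
  A^T = A /\ forall x : 'cV[R]_n, x != 0 -> 0 < quad_form A x.

Definition copositive (R : realType) (n : nat) (A : 'M[R]_n) : Prop :=
  A^T = A /\
  forall x : 'cV[R]_n, (forall i, 0 <= x i 0) -> 0 <= quad_form A x.

Definition rayleigh_values (R : realType) (n : nat) (A B : 'M[R]_n) : set R :=
  [set quad_form A x / quad_form B x | x in [set x : 'cV[R]_n | x != 0]].

Definition mu_min (R : realType) (n : nat) (A B : 'M[R]_n) : R :=
  set_min (rayleigh_values A B).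
Definition mu_max (R : realType) (n : nat) (A B : 'M[R]_n) : R :=
  set_max (rayleigh_values A B).

Definition rplus (R : realType) (n : nat) (M : 'M[R]_n) (i : 'I_n) : R :=
  \sum_(j < n | j != i) Num.max (M i j) 0.
Definition rminus (R : realType) (n : nat) (M : 'M[R]_n) (i : 'I_n) : R :=
  - \sum_(j < n | j != i) Num.min (M i j) 0.

Definition dplus (R : realType) (n : nat) (M : 'M[R]_n) (i : 'I_n) : R :=
  M i i + rplus M i.
Definition dminus (R : realType) (n : nat) (M : 'M[R]_n) (i : 'I_n) : R :=
  M i i - rminus M i.

Definition pplus (R : realType) (n : nat) (M : 'M[R]_n) (i j : 'I_n) : R :=
  M i i * M j j - rplus M i * rplus M j.
Definition pminus (R : realType) (n : nat) (M : 'M[R]_n) (i j : 'I_n) : R :=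
  M i i * M j j - rminus M i * rminus M j.

Definition splus (R : realType) (n : nat) (A B : 'M[R]_n) (i j : 'I_n) : R :=
  A i i * B j j + A j j * B i i + rplus A i * rminus B j + rplus A j * rminus B i.
Definition sminus (R : realType) (n : nat) (A B : 'M[R]_n) (i j : 'I_n) : R :=
  A i i * B j j + A j j * B i i + rminus A i * rplus B j + rminus A j * rplus B i.

Definition Pup (R : realType) (n : nat) (A B : 'M[R]_n) (i j : 'I_n) (y : R) : R :=
  pminus B i j * y ^+ 2 - splus A B i j * y + pplus A i j.
Definition Plow (R : realType) (n : nat) (A B : 'M[R]_n) (i j : 'I_n) (y : R) : R :=
  pplus B i j * y ^+ 2 - sminus A B i j * y + pminus A i j.

Definition K1 (R : realType) (n : nat) (A B : 'M[R]_n) : set R :=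
  \bigcup_(i in [set: 'I_n])
    `[Num.min (dminus A i / dminus B i) (dminus A i / dplus B i),
      Num.max (dplus A i / dminus B i) (dplus A i / dplus B i)]%classic.

Definition K2 (R : realType) (n : nat) (A B : 'M[R]_n) : set R :=
  \bigcup_(p in [set p : 'I_n * 'I_n | p.1 != p.2])
    `[Num.max 0 (set_min [set y | Plow A B p.1 p.2 y = 0]),
      set_max [set y | Pup A B p.1 p.2 y = 0]]%classic.

(* Main.v *)
(* The matrix [B] is [(beta - rho) I + rho E] with [rho <= r < beta], hence
   positive definite, and [A = c B] makes every Rayleigh quotient equal to [c].
   Both matrices are nonnegative off the diagonal with constant row sums, so
   [r_i^-] vanishes, all intervals in the unions [K_1] and [K_2] coincide, and
   the two quadratics factor as
     [P^low(y) = ((beta - r) y - c beta) ((beta + r) y - c beta)],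
     [P^up(y) = (beta y - c (beta + r)) (beta y - c (beta - r))]. *)
Require Import Defs.
From HB Require Import structures.
From mathcomp Require Import all_boot all_order all_algebra.
From mathcomp Require Import boolp classical_sets set_interval reals convex.
From mathcomp Require Import ring.

Set Implicit Arguments.
Unset Strict Implicit.
Unset Printing Implicit Defensive.

Import Order.TTheory GRing.Theory Num.Theory.

Local Open Scope classical_set_scope.
Local Open Scope ring_scope.

(** By antisymmetry a least element is unique, so the choice made by [xget] is forced and the dummy
    value 0 does not occur. *)
Lemma set_minE (R : realType) (S : set R) (x : R) :
  S x -> lbound S x -> set_min S = x.
Proof.
move=> Sx lx; apply: xget_unique => // y [Sy ly].
by apply/eqP; rewrite eq_le ly // lx.
Qed.

Lemma set_maxE (R : realType) (S : set R) (x : R) :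
  S x -> ubound S x -> set_max S = x.
Proof.
move=> Sx ux; apply: xget_unique => // y [Sy uy].
by apply/eqP; rewrite eq_le ux // uy.
Qed.

(** The interval is itself convex: swapping the two points turns the weight into its complement, so
    they may be taken in increasing order, and their combination then lies between them. *)
Lemma conv_hull_itv (R : realType) (a b : R) :
  conv_hull `[a, b]%classic = `[a, b]%classic.
Proof.
apply: smallest_id => x y t; rewrite !inE /= !in_itv /=.
move=> /andP[ax xb] /andP[ay yb].
wlog xy : x y t ax xb ay yb / x <= y => [hw|].
  by case: (leP x y) => [|/ltW] xy; [|rewrite convC]; exact: hw.
have := convR_itv t xy; rewrite in_itv /= => /andP[h1 h2].
by rewrite (le_trans ax h1) (le_trans h2 yb).
Qed.

Lemma quad_formD (R : realType) (n : nat) (M N : 'M[R]_n) (x : 'cV[R]_n) :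
  quad_form (M + N) x = quad_form M x + quad_form N x.
Proof. by rewrite /quad_form mulmxDr mulmxDl mxE. Qed.

Lemma quad_formZ (R : realType) (n : nat) (k : R) (M : 'M[R]_n) (x : 'cV[R]_n) :
  quad_form (k *: M) x = k * quad_form M x.
Proof. by rewrite /quad_form -scalemxAr -scalemxAl mxE. Qed.

Lemma quad_form1_gt0 (R : realType) (n : nat) (x : 'cV[R]_n) :
  x != 0 -> 0 < quad_form 1%:M x.
Proof.
move=> x0; rewrite /quad_form mulmx1 mxE.
have sq i : true -> 0 <= x^T 0 i * x i 0 by rewrite mxE -expr2 sqr_ge0.
rewrite lt0r sumr_ge0 // andbT psumr_eq0 //; apply: contra x0 => /allP x0.
apply/eqP/colP => i; move: (x0 i (mem_index_enum _)).
by rewrite !mxE -expr2 sqrf_eq0 => /eqP.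
Qed.

(** The form is the square of the scalar [v^T *m x]. *)
Lemma quad_form_rank1_ge0 (R : realType) (n : nat) (v x : 'cV[R]_n) :
  0 <= quad_form (v *m v^T) x.
Proof.
rewrite /quad_form mulmxA -[_ *m v^T *m x]mulmxA.
have -> : x^T *m v = (v^T *m x)^T by rewrite trmx_mul trmxK.
by rewrite !mxE big_ord1 mxE -expr2 sqr_ge0.
Qed.

Lemma positive_definite_copositive (R : realType) (n : nat) (M : 'M[R]_n) :
  positive_definite M -> copositive M.
Proof.
move=> [MT Mgt0]; split=> // x _; have [->|/Mgt0/ltW//] := eqVneq x 0.
by rewrite /quad_form mulmx0 mxE.
Qed.

Lemma positive_definiteZ (R : realType) (n : nat) (k : R) (M : 'M[R]_n) :
  0 < k -> positive_definite M -> positive_definite (k *: M).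
Proof.
move=> k0 [MT Mgt0]; split=> [|x x0]; first by rewrite linearZ /= MT.
by rewrite quad_formZ mulr_gt0 ?Mgt0.
Qed.

(** Every quotient cancels to [k]. The dimension is a successor so that some nonzero vector, here
    the all-ones one, makes the set nonempty. *)
Lemma rayleigh_valuesZ (R : realType) (n : nat) (k : R) (M : 'M[R]_n.+1) :
  positive_definite M -> rayleigh_values (k *: M) M = [set k].
Proof.
move=> [_ Mgt0].
have rayE x : x != 0 -> quad_form (k *: M) x / quad_form M x = k.
  by move=> x0; rewrite quad_formZ mulfK // gt_eqF ?Mgt0.
apply/seteqP; split=> [_ [x x0 <-]|_ ->] /=; first exact: rayE.
have one0 : const_mx 1 != 0 :> 'cV[R]_n.+1.
  by apply/eqP => /colP/(_ 0)/eqP; rewrite !mxE oner_eq0.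
by exists (const_mx 1); rewrite ?rayE.
Qed.

Lemma sum_neq_const (R : realType) (n : nat) (i : 'I_n) (k : R) :
  \sum_(j < n | j != i) k = (n%:R - 1) * k.
Proof.
have := sumr_const 'I_n k; rewrite (bigD1 i) //= card_ord => sumE.
rewrite mulrBl mul1r mulr_natl -sumE [k + _]addrC addrK.
exact: eq_bigl.
Qed.

Section ConstantOffDiagonal.
Variables (R : realType) (n : nat) (a b : R) (M : 'M[R]_n).
Hypothesis ME : forall i j, M i j = if i == j then a else b.
Hypothesis b_ge0 : 0 <= b.

Lemma rplus_offdiag_const i : rplus M i = (n%:R - 1) * b.
Proof.
rewrite -(sum_neq_const i); apply: eq_bigr => j ji.
by rewrite ME eq_sym (negbTE ji); apply/max_idPl.
Qed.

Lemma rminus_offdiag_const i : rminus M i = 0.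
Proof.
rewrite /rminus big1 ?oppr0 // => j ji.
by rewrite ME eq_sym (negbTE ji); apply/min_idPr.
Qed.

Lemma sum_abs_offdiag_const i :
  \sum_(j < n | j != i) `|M i j| = (n%:R - 1) * b.
Proof.
rewrite -(sum_neq_const i); apply: eq_bigr => j ji.
by rewrite ME eq_sym (negbTE ji) ger0_norm.
Qed.

End ConstantOffDiagonal.

Theorem proposition5p4 (R : realType) (n : nat) (beta r c : R)
  (hn : (2 <= n)%N) (hr : 0 < r) (hbeta : r < beta) (hc : 0 < c) :
  let e : 'cV[R]_n := const_mx 1 in
  let E : 'M[R]_n := e *m e^T in
  let rho : R := r / (n%:R - 1) in
  let B : 'M[R]_n := beta *: 1%:M + rho *: (E - 1%:M) in
  let A : 'M[R]_n := c *: B in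
  [/\ strictly_diag_dominant B,
      positive_definite B
    & copositive A]
  /\ [/\ conv_hull (K1 A B) = `[c * beta / (beta + r), c * (beta + r) / beta]%classic,
         conv_hull (K2 A B) = `[c * beta / (beta + r), c * (beta + r) / beta]%classic
       & `[mu_min A B, mu_max A B]%classic = [set c]]
  /\ (`[mu_min A B, mu_max A B]%classic `<` K1 A B /\ K1 A B = K2 A B).
Proof.
case: n hn => // m hn e E rho B A.
have n1 : 0 < m.+1%:R - 1 :> R by rewrite subr_gt0 ltr1n.
have rho0 : 0 < rho by rewrite /rho divr_gt0.
have nrho : (m.+1%:R - 1) * rho = r by rewrite /rho mulrC divfK // gt_eqF.
have rhor : rho <= r.
  have : 1 <= m.+1%:R - 1 :> R by rewrite lerBrDr -[1 + 1]/2%:R ler_nat.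
  by rewrite -nrho => h; rewrite ler_peMl // ltW.
have BE i j : B i j = if i == j then beta else rho.
  rewrite !mxE big_ord1 !mxE.
  by case: eqP => _; rewrite /= ?mulr1n ?mulr0n; ring.
have AE i j : A i j = if i == j then c * beta else c * rho.
  by rewrite mxE BE; case: ifP.
have crho0 : 0 < c * rho by rewrite mulr_gt0.
have Bpd : positive_definite B.
  split=> [|x x0].
    by apply/matrixP => i j; rewrite mxE !BE eq_sym.
  (* Regrouping the diagonal exhibits [B] as a positive multiple of the identity plus a nonnegative
     multiple of a rank-one square. *)
  have -> : B = (beta - rho) *: 1%:M + rho *: (e *m e^T).
    by rewrite /B -/E scalerBr scalerBl addrA addrAC.
  rewrite quad_formD !quad_formZ ltr_wpDr //.
    by rewrite mulr_ge0 ?quad_form_rank1_ge0 // ltW.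
  by rewrite mulr_gt0 ?quad_form1_gt0 // subr_gt0 (le_lt_trans rhor).
have rpB i : rplus B i = r by rewrite (rplus_offdiag_const BE) ?ltW.
have rmB i : rminus B i = 0 by rewrite (rminus_offdiag_const BE) ?ltW.
have rpA i : rplus A i = c * r.
  by rewrite (rplus_offdiag_const AE) ?ltW // mulrCA nrho.
have rmA i : rminus A i = 0 by rewrite (rminus_offdiag_const AE) ?ltW.
have Bii i : B i i = beta by rewrite BE eqxx.
have Aii i : A i i = c * beta by rewrite AE eqxx.
have beta0 : 0 < beta by apply: lt_trans hbeta.
have betar0 : 0 < beta + r by rewrite addr_gt0.
set lo := c * beta / (beta + r); set up := c * (beta + r) / beta.
have lo0 : 0 < lo by rewrite divr_gt0 ?mulr_gt0.
have loc : lo < c by rewrite ltr_pdivrMr // ltr_pM2l // ltrDl.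
have cup : c < up by rewrite ltr_pdivlMr // ltr_pM2l // ltrDl.
have K1E : K1 A B = `[lo, up]%classic.
  rewrite /K1 (eq_bigcupr (G := fun=> `[lo, up]%classic)) => [|i _].
    by rewrite bigcup_const //; exists ord0.
  (* In each of the minimum and the maximum, one of the two quotients cancels to [c]; the other is
     [lo], respectively [up], and wins because [lo < c < up]. *)
  rewrite /dplus /dminus rpA rpB rmA rmB Aii Bii !subr0 -mulrDr.
  rewrite mulfK ?gt_eqF // mulfK ?gt_eqF // -/lo -/up.
  by rewrite (min_idPr _) ?(max_idPl _) // ltW.
have Plow_min i j : set_min [set y | Plow A B i j y = 0] = lo.
  have PE y : Plow A B i j y =
      ((beta - r) * y - c * beta) * ((beta + r) * y - c * beta).
    by rewrite /Plow /pplus /pminus /sminus !(rpB, rmA, Aii, Bii); ring.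
  apply: set_minE => [|y] /=.
    by rewrite PE [(beta + r) * lo]mulrC divfK ?gt_eqF // subrr mulr0.
  rewrite PE => /eqP; rewrite mulf_eq0 !subr_eq0 => yE.
  rewrite ler_pdivrMr // [y * _]mulrC.
  case/orP: yE => /eqP yE; last by rewrite yE.
  (* At the other root, [(beta - r) * y = c * beta > 0] forces [y > 0], so replacing [beta - r] by
     [beta + r] can only increase the product; hence this root is at least [lo]. *)
  have y0 : 0 < y.
    by rewrite -(@pmulr_rgt0 _ (beta - r)) ?subr_gt0 // yE mulr_gt0.
  by rewrite -yE ler_pM2r // lerD2l ge0_cp // ltW.
have Pup_max i j : set_max [set y | Pup A B i j y = 0] = up.
  have PE y : Pup A B i j y =
      (beta * y - c * (beta + r)) * (beta * y - c * (beta - r)).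
    by rewrite /Pup /pplus /pminus /splus !(rpA, rmB, Aii, Bii); ring.
  apply: set_maxE => [|y] /=.
    by rewrite PE [beta * up]mulrC divfK ?gt_eqF // subrr mul0r.
  rewrite PE => /eqP; rewrite mulf_eq0 !subr_eq0 => yE.
  rewrite ler_pdivlMr // mulrC.
  (* The other root has numerator [c * (beta - r)], which is below [c * (beta + r)]. *)
  by case/orP: yE => /eqP -> //; rewrite ler_pM2l // lerD2l ge0_cp // ltW.
have K2E : K2 A B = `[lo, up]%classic.
  rewrite /K2 (eq_bigcupr (G := fun=> `[lo, up]%classic)) => [|p _].
    (* A union of equal intervals needs one admissible pair: the first and last indices differ
       because the dimension is at least 2. *)
    by rewrite bigcup_const //; exists (ord0, ord_max); rewrite /= -val_eqE /= lt_eqF.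
  by rewrite Plow_min Pup_max (max_idPr _) // ltW.
have muE : `[mu_min A B, mu_max A B]%classic = [set c].
  rewrite /mu_min /mu_max rayleigh_valuesZ //.
  by rewrite (set_minE (x := c)) ?(set_maxE (x := c)) ?set_itv1 // => _ ->.
split; [split=> //|split; [split=> //|split]].
- by move=> i; rewrite (sum_abs_offdiag_const BE) ?ltW // nrho Bii gtr0_norm.
- exact/positive_definite_copositive/positive_definiteZ.
- by rewrite K1E conv_hull_itv.
- by rewrite K2E conv_hull_itv.
(* The inclusion is strict because [lo] belongs to [K1 A B] but is smaller than [c]. *)
- rewrite muE K1E; split=> [_ ->|/(_ lo)] /=.
    by rewrite in_itv /= !ltW.
  rewrite in_itv /= lexx ltW ?(lt_trans loc) // => /(_ isT) loE.
  by rewrite loE ltxx in loc.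
- by rewrite K1E K2E.
Qed.
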